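(* Let $u\in C_{+,1/2}$ satisfy: (U0) $\inf_{r>0}u(r)=1$; (U2) $\limsup_{r\to\infty} r^{-1}\log u(r)<\infty$; (U3) $u$ is (log, $x^2$)-convex. Let $\alpha(n)=\dfrac{1}{\ell_u(n)\,n!}$ for $n\ge 0$. Then the sequence $\{\alpha(n)\}_{n\ge0}$ satisfies all of the following: (A1) $\alpha(0)=1$ and $\inf_{n\ge 0}\alpha(n)\sigma^n>0$ for some $\sigma\ge 1$; (A2) $\lim_{n\to\infty}\left(\frac{\alpha(n)}{n!}\right)^{1/n}=0$; (near-B2) the sequence $\{\alpha(n)/n!\}$ is nearly log-concave; ($\widetilde{\mathrm{B}}$2) the sequence $\left\{\frac{1}{n!\,\alpha(n)}\right\}$ is log-concave; (C2) there exists a constant $c_2$ such that $\alpha(n+m)\le c_2^{\,n+m}\alpha(n)\alpha(m)$ for all $n,m\ge0$; (C3) there exists a constant $c_3$ such that $\alpha(n)\alpha(m)\le c_3^{\,n+m}\alpha(n+m)$ for all $n,m\ge0$.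
   Context: $C_{+,1/2}$ is the set of all positive continuous functions $u$ on $[0,\infty)$ with $\lim_{r\to\infty}\frac{\log u(r)}{\sqrt r}=\infty$. The Legendre transform of such $u$ is $\ell_u(t)=\inf_{r>0}\frac{u(r)}{r^t}$, $t\in[0,\infty)$ (so $\ell_u(n)>0$ for all $n$). A positive continuous function $u$ on $[0,\infty)$ is (log, $x^k$)-convex ($k>0$) if $x\mapsto\log u(x^k)$ is convex on $[0,\infty)$. A sequence $\{\gamma(n)\}_{n\ge0}$ of positive numbers is log-concave if $\gamma(n)\gamma(n+2)\le\gamma(n+1)^2$ for all $n\ge0$. Two sequences $\{a(n)\}$, $\{b(n)\}$ of positive numbers are equivalent if there are positive constants $K_1,K_2,c_1,c_2$ with $K_1c_1^na(n)\le b(n)\le K_2c_2^na(n)$ for all $n$. A sequence is nearly log-concave if it is equivalent to a log-concave sequence. *)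

(* Defs.v *)
From HB Require Import structures.
From mathcomp Require Import all_boot all_order all_algebra.
From mathcomp Require Import all_classical all_reals all_analysis.
Set Implicit Arguments.
Unset Strict Implicit.
Unset Printing Implicit Defensive.
Import Order.TTheory GRing.Theory Num.Theory.
Import numFieldNormedType.Exports.
Local Open Scope classical_set_scope.
Local Open Scope ring_scope.

(* A function on [0, +oo[ is a total function R -> R of which only the values
   on [0, +oo[ are used. *)

Definition positive_continuous (R : realType) (u : R -> R) : Prop :=
  (forall r, 0 <= r -> 0 < u r) /\ {within `[0, +oo[, continuous u}.

Definition C_plus_half (R : realType) : set (R -> R) :=
  [set u | positive_continuous u /\
           ln (u r) / Num.sqrt r @[r --> +oo] --> +oo].

(* The infimum is that of a nonempty set of positive reals when u is positive
   on ]0, +oo[, so that the real-valued [inf] is the genuine one. *)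
Definition legendre (R : realType) (u : R -> R) (t : R) : R :=
  inf [set u r / r `^ t | r in `]0, +oo[].

Definition log_pow_convex (R : realType) (k : R) (u : R -> R) : Prop :=
  positive_continuous u /\
  @convex_function R R^o `[0, +oo[ (fun x : R => ln (u (x `^ k))).

Definition positive_seq (R : realType) (a : nat -> R) : Prop :=
  forall n, 0 < a n.

Definition log_concave (R : realType) (a : nat -> R) : Prop :=
  positive_seq a /\ forall n, a n * a n.+2 <= a n.+1 ^+ 2.

Definition equivalent_seq (R : realType) (a b : nat -> R) : Prop :=
  [/\ positive_seq a, positive_seq b &
    exists K1 K2 c1 c2 : R, [/\ 0 < K1, 0 < K2, 0 < c1, 0 < c2 &
      forall n, K1 * c1 ^+ n * a n <= b n <= K2 * c2 ^+ n * a n]].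

Definition nearly_log_concave (R : realType) (a : nat -> R) : Prop :=
  exists2 b : nat -> R, log_concave b & equivalent_seq a b.

(* Main.v *)
Require Import Defs.
From HB Require Import structures.
From mathcomp Require Import all_boot all_order all_algebra.
From mathcomp Require Import all_classical all_reals all_analysis.
From mathcomp Require Import ring lra zify.
Import Order.TTheory GRing.Theory Num.Theory.
Import numFieldNormedType.Exports.
Local Open Scope classical_set_scope.
Local Open Scope ring_scope.

(* For each fixed [r], [u r / r ^ n] is log-affine in [n], so its infimum
   [l n] over [r] is log-concave; since [l 0 = 1], [l] is submultiplicative and
   (C3) follows from the bound [2 ^ (n + m)] on binomial coefficients.
   Conversely, (U3) makes [log (u (x ^ 2)) + 2 t log (t / x)] jointly convex in
   [(t, x)], so that [l n * n ^ (2 * n)], its exponentiated infimum over [x], is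
   log-convex. As [n! <= n ^ n <= e ^ n * n!], this yields (near-B2), and
   (C2) then follows from the submultiplicativity of a log-concave sequence
   starting at 1. (A1) is obtained by taking [r] of order [n] in the infimum,
   and (A2) from [u r >= c * exp (A * sqrt r)] for every [A]. *)

(** * Log-concave sequences, elementary inequalities and midpoint convexity *)

Lemma log_concave_ratio (R : realType) (a : nat -> R) (n k : nat) :
  log_concave a -> a n * a (n + k).+1 <= a n.+1 * a (n + k)%N.
Proof.
move=> [a_gt0 a_lc]; elim: k => [|k IHk]; first by rewrite addn0 mulrC.
(* Ratios of consecutive terms decrease: chain the inductive hypothesis with log-concavity at
   [n + k], then cancel [a (n + k)]. *)
rewrite addnS -(ler_pM2r (a_gt0 (n + k)%N)).
have := ler_wpM2l (ltW (a_gt0 n)) (a_lc (n + k)%N).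
have := ler_wpM2r (ltW (a_gt0 (n + k).+1)) IHk.
by move=> h1 h2; rewrite expr2 in h2; lra.
Qed.

Lemma log_concave_submul (R : realType) (a : nat -> R) (n m : nat) :
  log_concave a -> a 0%N * a (n + m)%N <= a n * a m.
Proof.
move=> a_lc; have [a_gt0 _] := a_lc.
elim: n => [|n IHn]; first by rewrite add0n.
rewrite addSn -(ler_pM2r (a_gt0 n)).
have h1 := ler_wpM2l (ltW (a_gt0 0%N)) (@log_concave_ratio R a n m a_lc).
have h2 := ler_wpM2l (ltW (a_gt0 n.+1)) IHn.
by lra.
Qed.

Lemma expr_le_fact_expR (R : realType) (x : R) (n : nat) :
  0 <= x -> x ^+ n <= n`!%:R * expR x.
Proof.
move=> x_ge0; case: n => [|n].
  by rewrite expr0 fact0 mul1r; have := expR_ge1Dx x; lra.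
rewrite mulrC -ler_pdivrMr ?ltr0n ?fact_gt0//.
by apply: le_trans (expR_ge1Dxn n x_ge0); lra.
Qed.

Lemma fact_leq_expnn (n : nat) : (n`! <= n ^ n)%N.
Proof.
elim: n => // n IHn; rewrite factS expnS leq_mul2l /=.
by apply: leq_trans IHn _; case: n => // n; rewrite leq_exp2r.
Qed.

Lemma factD_leq (n m : nat) : ((n + m)`! <= 2 ^ (n + m) * (n`! * m`!))%N.
Proof.
have bin_le : forall k i, ('C(k, i) <= 2 ^ k)%N.
  elim=> [|k IHk] [|i] //; first by rewrite bin0 expn_gt0.
  by rewrite binS expnS mul2n -addnn leq_add.
rewrite -(@bin_fact (n + m) n) ?leq_addr// addKn.
by rewrite leq_mul2r bin_le orbT.
Qed.

(** Put [t = x / n] and raise [t <= expR (t - 1)] to the power [n]; the case [n = 0] relies on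
    [0 ^+ 0 = 1]. *)
Lemma expr_le_expnn_expR (R : realType) (x : R) (n : nat) :
  0 <= x -> x ^+ n <= n%:R ^+ n * expR (x - n%:R).
Proof.
move=> x_ge0; case: n => [|n].
  by rewrite !expr0 mul1r subr0; have := expR_ge1Dx x; lra.
have n_gt0 : 0 < n.+1%:R :> R by [].
rewrite {1}(_ : x = n.+1%:R * (x / n.+1%:R)); last by field; rewrite nat1r.
rewrite (_ : x - _ = n.+1%:R * (x / n.+1%:R - 1)); last by field; rewrite nat1r.
rewrite expRM_natl exprMn ler_pM2l ?exprn_gt0// lerXn2r ?nnegrE ?expR_ge0//.
  by rewrite divr_ge0// ltW.
by apply: le_trans (expR_ge1Dx _); rewrite ?(addrC 1) ?subrK ?lerDl.
Qed.

(* Weighted AM-GM, cleared of denominators and of roots. *)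
Lemma weighted_amgm_pow (R : realType) (n m : nat) (x y : R) :
  0 <= x -> 0 <= y -> 0 < x + y ->
  (n + m)%:R ^+ (n + m) * (x ^+ n * y ^+ m)
    <= n%:R ^+ n * m%:R ^+ m * (x + y) ^+ (n + m).
Proof.
move=> x_ge0 y_ge0 s_gt0; set N : R := (n + m)%:R.
have N_ge0 : 0 <= N by [].
have hx : 0 <= N * x / (x + y) by rewrite divr_ge0 ?mulr_ge0// ltW.
have hy : 0 <= N * y / (x + y) by rewrite divr_ge0 ?mulr_ge0// ltW.
have := ler_pM (exprn_ge0 n hx) (exprn_ge0 m hy)
  (@expr_le_expnn_expR R _ n hx) (@expr_le_expnn_expR R _ m hy).
rewrite mulrACA -expRD.
rewrite (_ : _ - _ + _ = 0); last first.
  by rewrite /N natrD; field; rewrite gt_eqF.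
rewrite expR0 mulr1 !exprMn !exprVn mulrACA -invfM -exprD.
by rewrite ler_pdivrMr ?exprn_gt0// mulrACA -exprD.
Qed.

Lemma log_pow_convex_midpoint (R : realType) (u : R -> R) (x y : R) :
  log_pow_convex 2 u -> 0 <= x -> 0 <= y ->
  u (((x + y) / 2) ^+ 2) ^+ 2 <= u (x ^+ 2) * u (y ^+ 2).
Proof.
move=> [[u_gt0 _] u_cvx] x_ge0 y_ge0.
have uX_gt0 z : 0 < u (z ^+ 2) by rewrite u_gt0// sqr_ge0.
have half_ge0 : 0 <= (2^-1 : R) by lra.
have half_le1 : (2^-1 : R) <= 1 by lra.
have xD : x \in (`[0, +oo[%classic : set R) by rewrite inE/= in_itv/= x_ge0.
have yD : y \in (`[0, +oo[%classic : set R) by rewrite inE/= in_itv/= y_ge0.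
have : ln (u ((2^-1 * x + (1 - 2^-1) * y) `^ 2))
    <= 2^-1 * ln (u (x `^ 2)) + (1 - 2^-1) * ln (u (y `^ 2)).
  exact: u_cvx (Itv01 half_ge0 half_le1) x y xD yD.
rewrite (_ : 2^-1 * x + (1 - 2^-1) * y = (x + y) / 2); last by field.
rewrite !powR_mulrn//; last by rewrite divr_ge0// addr_ge0.
move=> h; rewrite -ler_ln ?posrE ?exprn_gt0 ?mulr_gt0//.
by rewrite lnXn// lnM ?posrE// mulr2n; lra.
Qed.

(** * The Legendre transform as an infimum *)

Lemma legendre_le (R : realType) (u : R -> R) (n : nat) (r : R) :
  (forall s, 0 < s -> 0 < u s) -> 0 < r -> legendre u n%:R <= u r / r ^+ n.
Proof.
move=> u_gt0 r_gt0; rewrite -(powR_mulrn n (ltW r_gt0)).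
apply: ge_inf; last by exists r; rewrite //= in_itv/= r_gt0.
exists 0 => _ [s + <-]; rewrite /= in_itv/= andbT => s_gt0.
by rewrite divr_ge0 ?powR_ge0// ltW// u_gt0.
Qed.

Lemma legendre_ge (R : realType) (u : R -> R) (n : nat) (c : R) :
  (forall r, 0 < r -> c <= u r / r ^+ n) -> c <= legendre u n%:R.
Proof.
move=> le_c; apply: lb_le_inf.
  by exists (u 1 / 1 `^ n%:R), 1; rewrite //= in_itv/= ltr01.
move=> _ [s + <-]; rewrite /= in_itv/= andbT => s_gt0.
by rewrite (powR_mulrn n (ltW s_gt0)); exact: le_c.
Qed.

(** The two infima are treated one after the other: divide by the first, fix [s], then divide by
    [u s / s ^+ m] and let [r] vary. *)
Lemma legendreM_ge (R : realType) (u : R -> R) (n m : nat) (c : R) :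
  0 < legendre u n%:R ->
  (forall r, 0 < r -> 0 < u r) ->
  (forall r s, 0 < r -> 0 < s -> c <= (u r / r ^+ n) * (u s / s ^+ m)) ->
  c <= legendre u n%:R * legendre u m%:R.
Proof.
move=> l_gt0 u_gt0 le_c; rewrite -ler_pdivrMl//.
apply: legendre_ge => s s_gt0.
rewrite ler_pdivrMl// -ler_pdivrMr ?divr_gt0 ?u_gt0 ?exprn_gt0//.
apply: legendre_ge => r r_gt0.
by rewrite ler_pdivrMr ?divr_gt0 ?u_gt0 ?exprn_gt0//; exact: le_c.
Qed.

(** * Lower bounds and convexity *)

Lemma C_plus_half_growth (R : realType) (u : R -> R) (A : R) :
  C_plus_half u -> (forall r, 0 < r -> 1 <= u r) -> 0 <= A ->
  exists2 c : R, 0 < c & forall r, 0 < r -> c * expR (A * Num.sqrt r) <= u r.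
Proof.
move=> [[u_gt0 _] /cvgryPge/(_ A) [r0 [_ u_growth]]] u_ge1 A_ge0.
(* This constant keeps the left side at most [1 <= u r] up to the threshold [r0]; beyond [r0] the
   growth of [u] suffices. *)
exists (expR (- (A * Num.sqrt r0))); first exact: expR_gt0.
move=> r r_gt0; rewrite -expRD.
have [r_le|r_gt] := leP r r0.
  apply: le_trans (u_ge1 r r_gt0); rewrite expR_le1 addrC subr_le0.
  by rewrite ler_wpM2l// ler_wsqrtr.
have := u_growth r r_gt; rewrite /= ler_pdivlMr ?sqrtr_gt0// => h.
rewrite -[leRHS]lnK ?posrE ?(u_gt0 r (ltW r_gt0))// ler_expR.
by apply: le_trans h; rewrite gerDr oppr_le0 mulr_ge0// sqrtr_ge0.
Qed.

(* [expR (2 * sqrt (M * r)) >= (4 * M * r) ^ n / (2 * n)!], and the factorial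
   is at most [4 ^ n * n! ^ 2]. *)
Lemma legendre_fact_growth (R : realType) (u : R -> R) (M : R) :
  C_plus_half u -> (forall r, 0 < r -> 1 <= u r) -> 0 <= M ->
  exists2 c : R, 0 < c &
    forall n : nat, c * M ^+ n <= legendre u n%:R * n`!%:R ^+ 2.
Proof.
move=> u_C u_ge1 M_ge0.
have A_ge0 : 0 <= 2 * Num.sqrt M by rewrite mulr_ge0 ?sqrtr_ge0.
have [c c_gt0 u_ge] := @C_plus_half_growth R u _ u_C u_ge1 A_ge0.
exists c => // n.
have f_gt0 : 0 < n`!%:R :> R by rewrite ltr0n fact_gt0.
rewrite -ler_pdivrMr ?exprn_gt0//; apply: legendre_ge => r r_gt0.
rewrite ler_pdivrMr ?exprn_gt0// mulrAC ler_pdivlMr ?exprn_gt0//.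
have As_ge0 : 0 <= 2 * Num.sqrt M * Num.sqrt r by rewrite mulr_ge0 ?sqrtr_ge0.
have := @expr_le_fact_expR R _ (n + n) As_ge0.
rewrite addnn -mul2n exprM.
rewrite (_ : _ ^+ 2 = 2 ^+ 2 * M * r); last first.
  by rewrite exprMn (exprMn 2) !sqr_sqrtr// ltW.
rewrite (exprMn n (_ * M)) (exprMn n _ M) => h1.
have h2 : (2 * n)`!%:R <= 2 ^+ 2 ^+ n * n`!%:R ^+ 2 :> R.
  rewrite -exprM !expr2 -natrX -!natrM ler_nat.
  by rewrite mul2n -addnn; exact: factD_leq.
have {}h1 := le_trans h1 (ler_wpM2r (expR_ge0 _) h2).
have {h1}h3 :
    M ^+ n * r ^+ n <= n`!%:R ^+ 2 * expR (2 * Num.sqrt M * Num.sqrt r).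
  by move: h1; rewrite -!(mulrA (2 ^+ 2 ^+ n)) ler_pM2l ?exprn_gt0.
have {}h3 := ler_wpM2l (ltW c_gt0) h3.
have h4 := ler_wpM2r (exprn_ge0 2 (ltW f_gt0)) (u_ge r r_gt0).
by lra.
Qed.

(** With [r = x ^+ 2] and [s = y ^+ 2], test the infimum of index [n.+1] at the square of the
    midpoint of [x] and [y]. Midpoint convexity controls the values of [u], and AM-GM with weights
    [n] and [n.+2] controls the powers. *)
Lemma legendre_expnn_log_concave (R : realType) (u : R -> R) :
  log_pow_convex 2 u -> (forall n : nat, 0 < legendre u n%:R) ->
  log_concave (fun n => 1 / (legendre u n%:R * (n%:R ^+ n) ^+ 2)).
Proof.
move=> u_cvx l_gt0; have [[u_ge0_gt0 _] _] := u_cvx.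
have u_gt0 r : 0 < r -> 0 < u r by move=> r_gt0; rewrite u_ge0_gt0// ltW.
have p_gt0 n : 0 < n%:R ^+ n :> R.
  by rewrite -natrX ltr0n expn_gt0; case: n.
have h_gt0 n : 0 < legendre u n%:R * (n%:R ^+ n) ^+ 2.
  by rewrite mulr_gt0// exprn_gt0.
split=> [n|n] /=; first by rewrite divr_gt0.
rewrite !div1r -invfM exprVn lef_pV2 ?posrE; last 2 first.
- by rewrite mulr_gt0.
- by rewrite exprn_gt0.
set P : R := n.+1%:R ^+ n.+1; set Q : R := n%:R ^+ n * n.+2%:R ^+ n.+2.
have P_gt0 : 0 < P := p_gt0 n.+1.
have Q_gt0 : 0 < Q by rewrite mulr_gt0.
rewrite exprMn [leRHS]mulrACA -(exprMn 2 (n%:R ^+ n)) -/P -/Q.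
rewrite -ler_pdivrMr ?exprn_gt0//.
apply: legendreM_ge => // r s r_gt0 s_gt0.
set x := Num.sqrt r; set y := Num.sqrt s.
have x_gt0 : 0 < x by rewrite sqrtr_gt0.
have y_gt0 : 0 < y by rewrite sqrtr_gt0.
have rE : r = x ^+ 2 by rewrite sqr_sqrtr// ltW.
have sE : s = y ^+ 2 by rewrite sqr_sqrtr// ltW.
have q_gt0 : 0 < ((x + y) / 2) ^+ 2 by rewrite exprn_gt0// divr_gt0// addr_gt0.
set q := ((x + y) / 2) ^+ 2 in q_gt0.
set D := q ^+ n.+1; have D_gt0 : 0 < D by rewrite exprn_gt0.
have uq_le : (legendre u n.+1%:R * D) ^+ 2 <= u r * u s.
  apply: le_trans (_ : u q ^+ 2 <= _).
    apply: lerXn2r; rewrite ?nnegrE; [| exact: ltW (u_gt0 _ q_gt0) |].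
      by rewrite ltW// mulr_gt0.
    by rewrite -ler_pdivlMr//; exact: legendre_le.
  by rewrite rE sE; apply: log_pow_convex_midpoint => //; exact: ltW.
(* The weights add up to [2 * n.+1], so the powers of 2 coming from the total weight and from the
   midpoint cancel. *)
have amgm : P ^+ 2 * (x ^+ n * y ^+ n.+2) <= Q * D.
  have nE : (n + n.+2)%N = (2 * n.+1)%N by lia.
  have := @weighted_amgm_pow R n n.+2 x y (ltW x_gt0) (ltW y_gt0)
    (addr_gt0 x_gt0 y_gt0).
  rewrite nE natrM exprMn -/Q.
  rewrite (_ : (x + y) ^+ _ = 2 ^+ (2 * n.+1) * D); last first.
    by rewrite /D /q -exprM -exprMn mulrC divfK.
  rewrite -mulrA (mulrCA Q) ler_pM2l ?exprn_gt0// => h.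
  by rewrite /P -exprM mulnC.
rewrite [leRHS]mulrACA -invfM ler_pdivlMr; last by rewrite mulr_gt0// exprn_gt0.
rewrite [leLHS]mulrAC ler_pdivrMr ?exprn_gt0// [leRHS]mulrC.
(* What remains is the square of [amgm], since [r ^+ n * s ^+ n.+2] is the square of
   [x ^+ n * y ^+ n.+2]. *)
apply: le_trans (ler_wpM2l (exprn_ge0 2 (ltW Q_gt0)) uq_le).
rewrite (exprMn 2 _ D) -[leLHS]mulrA [leRHS]mulrCA ler_pM2l ?exprn_gt0//.
rewrite -exprMn {1}rE {1}sE -!exprM (mulnC 2 n) (mulnC 2 n.+2) !exprM -!exprMn.
apply: lerXn2r => //; rewrite nnegrE; last by rewrite ltW// mulr_gt0.
by rewrite ltW// mulr_gt0 ?(exprn_gt0 2)// mulr_gt0// exprn_gt0.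
Qed.

(** * Upper bounds and convergence of roots *)

Lemma exponential_bound (R : realType) (u : R -> R) :
  (forall r, 0 < r -> 0 < u r) ->
  (limf_esup (fun r : R => (r^-1 * ln (u r))%:E) (pinfty_nbhs R) < +oo)%E ->
  exists2 a : R, 0 <= a &
    exists N : nat, forall r, N%:R < r -> u r <= expR (a * r).
Proof.
move=> u_gt0 /ereal_inf_lt[_ [V [r0 [_ r0V]] <-] sup_lt].
have [a a_ge0 V_le] : exists2 a : R, 0 <= a &
    forall r, V r -> r^-1 * ln (u r) <= a.
  (* When [V] has a point, the supremum is finite, so [fine] returns its true value; the maximum
     ensures [0 <= a]. *)
  exists (Num.max 0 (fine (ereal_sup [set (r^-1 * ln (u r))%:E | r in V]))).
    by rewrite le_max lexx.
  move=> r Vr; rewrite le_max; apply/orP; right.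
  have ub : ((r^-1 * ln (u r))%:E <=
      ereal_sup [set (r^-1 * ln (u r))%:E | r in V])%E.
    by apply: ereal_sup_ubound; exists r.
  by move: sup_lt ub; case: ereal_sup.
exists a => //; exists (Num.truncn `|r0|).+1 => r r_gt.
have r0_lt : r0 < r.
  by rewrite (le_lt_trans (ler_norm r0))// (lt_trans _ r_gt)// truncnS_gt.
have r_gt0 : 0 < r by apply: le_lt_trans r_gt.
have := V_le _ (r0V _ r0_lt); rewrite mulrC ler_pdivrMr// => h.
by rewrite -[leLHS]lnK ?ler_expR// posrE u_gt0.
Qed.

Lemma legendre_fact_bound (R : realType) (u : R -> R) :
  (forall r, 0 < r -> 0 < u r) ->
  (limf_esup (fun r : R => (r^-1 * ln (u r))%:E) (pinfty_nbhs R) < +oo)%E ->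
  exists2 C : R, 0 < C & exists2 sigma : R, 1 <= sigma &
    forall n : nat, legendre u n%:R * n`!%:R <= C * sigma ^+ n.
Proof.
move=> u_gt0 /(@exponential_bound R u u_gt0)[a a_ge0 [N u_le]].
exists (expR (a * N.+1%:R)); first exact: expR_gt0.
exists (expR a) => [|n]; first by rewrite -expR0 ler_expR.
rewrite -expRM_natr -expRD -mulrDr -natrD.
(* This [r] exceeds the threshold [N], satisfies [n! <= n ^ n <= r ^ n], and is linear in [n], so
   [expR (a * r)] is geometric. *)
set r : R := (N.+1 + n)%:R.
have r_gt0 : 0 < r by rewrite ltr0n.
apply: le_trans (_ : u r <= _); last by apply: u_le; rewrite ltr_nat; lia.
apply: le_trans (ler_wpM2r _ (@legendre_le R u n r u_gt0 r_gt0)) _ => //.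
rewrite mulrAC ler_pdivrMr ?exprn_gt0// ler_pM2l ?u_gt0//.
rewrite -natrX ler_nat (leq_trans (fact_leq_expnn n))//.
by case: n @r r_gt0 => // n _ _; rewrite leq_exp2r// leq_addl.
Qed.

Lemma one_le_of_inf (R : realType) (u : R -> R) :
  (forall r, 0 < r -> 0 < u r) -> inf [set u r | r in `]0, +oo[] = 1 ->
  forall r, 0 < r -> 1 <= u r.
Proof.
move=> u_gt0 infE r r_gt0; rewrite -infE; apply: ge_inf.
  exists 0 => _ [s + <-]; rewrite /= in_itv/= andbT => s_gt0.
  exact: ltW (u_gt0 s s_gt0).
by exists r; rewrite //= in_itv/= r_gt0.
Qed.

Lemma root_cvg0 (R : realType) (x : nat -> R) :
  (forall n, 0 <= x n) ->
  (forall e, 0 < e -> exists2 C : R, 0 <= C & forall n, x n <= C * e ^+ n) ->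
  x n `^ (1 / n%:R) @[n --> \oo] --> (0 : R).
Proof.
move=> x_ge0 x_le; apply/cvgrPdist_le => e e_gt0.
(* Halving [e] leaves a factor [2 ^ n] that eventually absorbs [C]. *)
have [C C_ge0 xC] := x_le (e / 2) (divr_gt0 e_gt0 (ltr0n _ 2)).
near=> n; rewrite sub0r normrN ger0_norm ?powR_ge0//.
have n_gt0 : (0 < n)%N by near: n; exact: nbhs_infty_gt.
have C_le : C <= n%:R by near: n; exact: nbhs_infty_ger.
have x_le_e : x n <= e ^+ n.
  apply: le_trans (xC n) _.
  rewrite exprMn mulrCA ler_piMr ?exprn_ge0 ?(ltW e_gt0)//.
  rewrite exprVn ler_pdivrMr ?exprn_gt0// mul1r (le_trans C_le)//.
  by rewrite -natrX ler_nat ltnW// ltn_expl.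
have -> : e = (e ^+ n) `^ (1 / n%:R).
  rewrite -powR_mulrn ?(ltW e_gt0)// -powRrM mulrC divfK ?powRr1 ?(ltW e_gt0)//.
  by rewrite pnatr_eq0 -lt0n.
by apply: ge0_ler_powR; rewrite ?nnegrE ?divr_ge0 ?exprn_ge0// ltW.
Unshelve. all: by end_near. Qed.

(** * From a sequence [l] to [alpha] *)

Definition fact_dual {R : realType} (l : nat -> R) (n : nat) : R :=
  1 / (l n * n`!%:R).

(** The log-concave sequence to which [fact_dual l n / n!] is compared: [n ^ n] replaces [n!]. *)
Definition expnn_dual {R : realType} (l : nat -> R) (n : nat) : R :=
  1 / (l n * (n%:R ^+ n) ^+ 2).

Lemma factR_gt0 (R : realType) (n : nat) : 0 < n`!%:R :> R.
Proof. by rewrite ltr0n fact_gt0. Qed.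

Lemma fact_dual_gt0 (R : realType) (l : nat -> R) (n : nat) :
  (forall k, 0 < l k) -> 0 < fact_dual l n.
Proof. by move=> l_gt0; rewrite divr_gt0// mulr_gt0// factR_gt0. Qed.

Lemma fact_dual_factE (R : realType) (l : nat -> R) (n : nat) :
  fact_dual l n / n`!%:R = 1 / (l n * n`!%:R ^+ 2).
Proof. by rewrite /fact_dual -mulrA -invfM mulrA. Qed.

Lemma factR_le_expnn (R : realType) (n : nat) : n`!%:R <= n%:R ^+ n :> R.
Proof. by rewrite -natrX ler_nat fact_leq_expnn. Qed.

Lemma expnn_le_factR (R : realType) (n : nat) :
  n%:R ^+ n <= n`!%:R * expR 1 ^+ n :> R.
Proof. by rewrite -expRM_natr mul1r; exact: expr_le_fact_expR. Qed.

Lemma fact_dual_expnn_dual (R : realType) (l : nat -> R) (n : nat) :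
  (forall k, 0 < l k) ->
  expnn_dual l n <= fact_dual l n / n`!%:R /\
  fact_dual l n / n`!%:R <= (expR 1 ^+ 2) ^+ n * expnn_dual l n.
Proof.
move=> l_gt0.
have p_gt0 : 0 < n%:R ^+ n :> R.
  exact: lt_le_trans (factR_gt0 R n) (factR_le_expnn R n).
have f_gt0 := factR_gt0 R n.
rewrite fact_dual_factE /expnn_dual !div1r; split.
  rewrite lef_pV2 ?posrE ?mulr_gt0 ?(exprn_gt0 2)//.
  by rewrite ler_pM2l//; apply: lerXn2r; rewrite ?nnegrE ?factR_le_expnn// ltW.
rewrite ler_pdivlMr ?mulr_gt0 ?(exprn_gt0 2)//.
rewrite mulrC ler_pdivrMr ?mulr_gt0 ?(exprn_gt0 2)//.
rewrite [leRHS]mulrCA ler_pM2l// (exprAC (expR 1)) -exprMn mulrC.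
by apply: lerXn2r; rewrite ?nnegrE ?expnn_le_factR// ltW// mulr_gt0.
Qed.

Lemma fact_dual_nearly_log_concave (R : realType) (l : nat -> R) :
  (forall k, 0 < l k) ->
  log_concave (expnn_dual l) ->
  nearly_log_concave (fun n => fact_dual l n / n`!%:R).
Proof.
move=> l_gt0 b_lc; exists (expnn_dual l) => //; split.
- by move=> n; rewrite divr_gt0 ?factR_gt0 ?fact_dual_gt0.
- by case: b_lc.
exists 1, 1, ((expR 1 ^+ 2)^-1), 1.
have e_gt0 : 0 < expR 1 ^+ 2 :> R by rewrite exprn_gt0 ?expR_gt0.
split; rewrite ?invr_gt0// => n.
have [h1 h2] := @fact_dual_expnn_dual R l n l_gt0.
rewrite !mul1r expr1n mul1r h1 andbT.
by rewrite exprVn mulrC ler_pdivrMr ?(exprn_gt0 n)// [leRHS]mulrC.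
Qed.

(** Passing to [expnn_dual] at [n + m] costs [e ^ (2 * (n + m))], returning at [n] and at [m] costs
    nothing, and splitting [(n + m)!] costs [2 ^ (n + m)]. *)
Lemma fact_dual_submul (R : realType) (l : nat -> R) (n m : nat) :
  (forall k, 0 < l k) -> l 0%N = 1 -> log_concave (expnn_dual l) ->
  fact_dual l (n + m)%N <=
    (2 * expR 1 ^+ 2) ^+ (n + m) * fact_dual l n * fact_dual l m.
Proof.
move=> l_gt0 l0 b_lc; have [b_gt0 _] := b_lc.
have b0 : expnn_dual l 0%N = 1.
  by rewrite /expnn_dual l0 expr0 expr1n !mulr1 divr1.
have := @log_concave_submul R (expnn_dual l) n m b_lc; rewrite b0 mul1r => bnm.
have [_ h] := @fact_dual_expnn_dual R l (n + m) l_gt0.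
rewrite ler_pdivrMr ?factR_gt0// in h.
have [hn _] := @fact_dual_expnn_dual R l n l_gt0.
have [hm _] := @fact_dual_expnn_dual R l m l_gt0.
apply: le_trans h _.
have e_gt0 : 0 < (expR 1 ^+ 2) ^+ (n + m) :> R by rewrite !exprn_gt0 ?expR_gt0.
have -> : (2 * expR 1 ^+ 2) ^+ (n + m) * fact_dual l n * fact_dual l m
    = (expR 1 ^+ 2) ^+ (n + m) *
      (2 ^+ (n + m) * (fact_dual l n * fact_dual l m)).
  by rewrite (exprMn (n + m) 2); ring.
rewrite -[leLHS]mulrA ler_pM2l// [leLHS]mulrC.
have fle : (n + m)`!%:R <= 2 ^+ (n + m) * (n`!%:R * m`!%:R) :> R.
  by rewrite -natrX -!natrM ler_nat factD_leq.
have hb := ler_pM (ltW (b_gt0 n)) (ltW (b_gt0 m)) hn hm.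
have := ler_pM (ltW (factR_gt0 R _)) (ltW (b_gt0 _)) fle (le_trans bnm hb).
move=> /le_trans; apply.
rewrite le_eqVlt; apply/orP; left; apply/eqP.
by field; rewrite !gt_eqF ?factR_gt0.
Qed.

Lemma fact_dual_supermul (R : realType) (l : nat -> R) (n m : nat) :
  l 0%N = 1 -> log_concave l ->
  fact_dual l n * fact_dual l m <= 2 ^+ (n + m) * fact_dual l (n + m)%N.
Proof.
move=> l0 l_lc; have [l_gt0 _] := l_lc.
have := @log_concave_submul R l n m l_lc; rewrite l0 mul1r => lnm.
have f_gt0 k : 0 < k`!%:R :> R by exact: factR_gt0.
rewrite /fact_dual !div1r -invfM.
rewrite ler_pdivlMr ?mulr_gt0// mulrC ler_pdivrMr ?mulr_gt0//.
rewrite (mulrACA (l n)) [leRHS]mulrCA.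
apply: ler_pM => //; first exact: ltW.
by rewrite -natrX -!natrM ler_nat factD_leq.
Qed.

(** * Log-concavity of the transform, and assembly *)

Lemma legendre_log_concave (R : realType) (u : R -> R) :
  (forall r, 0 < r -> 0 < u r) -> (forall n : nat, 0 < legendre u n%:R) ->
  log_concave (fun n => legendre u n%:R).
Proof.
move=> u_gt0 l_gt0; split=> // n.
(* Square roots turn the goal into a lower bound for the single infimum of index [n.+1]. *)
rewrite -ler_sqrt ?exprn_ge0 ?(ltW (l_gt0 _))//.
rewrite sqrtr_sqr ger0_norm ?(ltW (l_gt0 _))//.
apply: legendre_ge => r r_gt0.
have w_ge0 : 0 <= u r / r ^+ n.+1.
  by rewrite ltW// divr_gt0 ?u_gt0 ?(exprn_gt0 n.+1).
rewrite -(ger0_norm w_ge0) -sqrtr_sqr ler_wsqrtr//.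
have -> : (u r / r ^+ n.+1) ^+ 2 = (u r / r ^+ n) * (u r / r ^+ n.+2).
  by rewrite !exprS; field; rewrite ?expf_neq0 ?gt_eqF.
by apply: ler_pM; rewrite ?(ltW (l_gt0 _))//; exact: legendre_le.
Qed.

Theorem theorem3p7 (R : realType) (u : R -> R)
  (u_C : C_plus_half u)
  (U0 : inf [set u r | r in `]0, +oo[] = 1)
  (U2 : (limf_esup (fun r : R => (r^-1 * ln (u r))%:E) (pinfty_nbhs R) < +oo)%E)
  (U3 : log_pow_convex 2 u) :
  let alpha := fun n : nat => 1 / (legendre u n%:R * n`!%:R) in
  (* A1 *)
  (alpha 0%N = 1 /\
   exists2 sigma : R, 1 <= sigma &
     0 < inf [set alpha n * sigma ^+ n | n in [set: nat]]) /\
  (* A2 *)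
  ((alpha n / n`!%:R) `^ (1 / n%:R) @[n --> \oo] --> (0 : R)) /\
  (* near-B2 *)
  nearly_log_concave (fun n => alpha n / n`!%:R) /\
  (* B2-tilde *)
  log_concave (fun n => 1 / (n`!%:R * alpha n)) /\
  (* C2 *)
  (exists c2 : R, forall n m : nat,
     alpha (n + m)%N <= c2 ^+ (n + m) * alpha n * alpha m) /\
  (* C3 *)
  (exists c3 : R, forall n m : nat,
     alpha n * alpha m <= c3 ^+ (n + m) * alpha (n + m)%N).
Proof.
have [[u_ge0_gt0 _] _] := u_C.
have u_gt0 r : 0 < r -> 0 < u r by move=> r_gt0; rewrite u_ge0_gt0// ltW.
have u_ge1 := @one_le_of_inf R u u_gt0 U0.
have l_gt0 n : 0 < legendre u n%:R.
  (* The growth bound with [M = 1] already bounds the infimum away from 0. *)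
  have [c c_gt0 /(_ n)] := @legendre_fact_growth R u 1 u_C u_ge1 ler01.
  rewrite expr1n mulr1 => /(lt_le_trans c_gt0).
  by rewrite pmulr_lgt0// exprn_gt0// factR_gt0.
have l0 : legendre u 0%:R = 1.
  rewrite /legendre -U0; congr inf; apply: eq_imagel => r _.
  by rewrite powRr0 divr1.
pose l (n : nat) := legendre u n%:R.
move=> alpha; have alphaE : alpha = fact_dual l by [].
have alpha_gt0 n : 0 < alpha n by rewrite alphaE; exact: fact_dual_gt0.
have b_lc := @legendre_expnn_log_concave R u U3 l_gt0.
have l_lc := @legendre_log_concave R u u_gt0 l_gt0.
split; first split.
- by rewrite alphaE /fact_dual /l l0 mulr1 divr1.
- have [C C_gt0 [sigma sigma_ge1 l_le]] := @legendre_fact_bound R u u_gt0 U2.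
  exists sigma => //; apply: lt_le_trans (_ : C^-1 <= _).
    by rewrite invr_gt0.
  apply: lb_le_inf; first by exists (alpha 0%N * sigma ^+ 0), 0%N.
  move=> _ [n _ <-]; rewrite /alpha div1r mulrC.
  rewrite ler_pdivlMr ?mulr_gt0 ?factR_gt0// mulrC ler_pdivrMr//.
  by rewrite [leRHS]mulrC l_le.
split.
  apply: root_cvg0 => [n|e e_gt0]; first by rewrite divr_ge0// ltW.
  have eV_ge0 : 0 <= e^-1 by rewrite invr_ge0 ltW.
  (* Taking [M = e^-1] gives [alpha n / n! <= c^-1 * e ^+ n]. *)
  have [c c_gt0 l_ge] := @legendre_fact_growth R u e^-1 u_C u_ge1 eV_ge0.
  exists c^-1 => [|n]; first by rewrite invr_ge0 ltW.
  rewrite alphaE fact_dual_factE div1r -[e in leRHS]invrK exprVn -invfM.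
  rewrite lef_pV2 ?posrE ?l_ge// mulr_gt0 ?(exprn_gt0 2) ?(exprn_gt0 n)//.
    by rewrite l_gt0.
  by rewrite invr_gt0.
split; first exact: fact_dual_nearly_log_concave.
split.
  have -> // : (fun n => 1 / (n`!%:R * alpha n)) = l.
  apply/funext => n; rewrite /alpha -/(l n).
  by rewrite !div1r invfM invrK mulrC mulfK// gt_eqF// factR_gt0.
split.
  exists (2 * expR 1 ^+ 2) => n m.
  exact: (@fact_dual_submul R l n m l_gt0 l0 b_lc).
by exists 2 => n m; exact: (@fact_dual_supermul R l n m l0 l_lc).
Qed.
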